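(* The sequence $\{P_n^{(-1,-1)}(x)\}_{n=2}^{\infty}$ forms a complete orthogonal set in the Hilbert space $L^2_{-1,-1}(-1,1)$. Equivalently, the set $\mathcal{P}_{-1}[-1,1]$ of all polynomials $p$ of degree $\ge2$ satisfying $p(\pm1)=0$ is dense in $L^2_{-1,-1}(-1,1)$. In particular, $P_n^{(-1,-1)}(\pm1)=0$ for all $n\ge2$.
   Context: $L^2_{-1,-1}(-1,1)=L^2((-1,1);(1-x^2)^{-1})$ with inner product $(f,g)_{-1,-1}=\int_{-1}^1 f(x)\overline{g}(x)(1-x^2)^{-1}dx$. For $n\ge2$, $P_n^{(-1,-1)}$ is any fixed non-zero multiple of $$\sum_{j=0}^n\binom{n-1}{j}\binom{n-1}{n-j}\Big(\frac{x-1}{2}\Big)^j\Big(\frac{x+1}{2}\Big)^{n-j},$$ where $\binom{n-1}{n}=0$. *)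

(* Defs.v *)
From HB Require Import structures.
From mathcomp Require Import all_boot all_order all_algebra.
From mathcomp Require Import complex.
From mathcomp Require Import all_classical all_reals all_analysis.
Set Implicit Arguments.
Unset Strict Implicit.
Unset Printing Implicit Defensive.
Import Order.TTheory GRing.Theory Num.Theory.
Import numFieldNormedType.Exports.

Local Open Scope classical_set_scope.
Local Open Scope ring_scope.
Local Open Scope complex_scope.

Section WeightedL2.
Variable R : realType.

Local Notation mu := (@lebesgue_measure R).
Local Notation I11 := (`]-1, 1[%classic : set R).

Definition weight (x : R) : R := (1 - x ^+ 2)^-1.

Definition cintegral (D : set R) (h : R -> R[i]) : R[i] :=
  (\int[mu]_(x in D) complex.Re (h x))
    +i* (\int[mu]_(x in D) complex.Im (h x)).

(* Elements of the Hilbert space are represented by functions on R of which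
   only the values on ]-1, 1[ matter, two functions being identified when they
   agree almost everywhere there; the null vectors are given by [ae_zero]. *)
Definition L2w (f : R -> R[i]) : Prop :=
  [/\ measurable_fun I11 (fun x => complex.Re (f x)),
      measurable_fun I11 (fun x => complex.Im (f x)) &
      (\int[mu]_(x in I11) ((Normc.normc (f x) ^+ 2 * weight x)%:E) < +oo)%E].

Definition ae_zero (f : R -> R[i]) : Prop :=
  {ae mu, forall x, I11 x -> f x = 0}.

(* [cintegral] is meaningful only for integrable functions, which the
   integrand is when f and g are in [L2w] (Cauchy-Schwarz). *)
Definition innerw (f g : R -> R[i]) : R[i] :=
  cintegral I11 (fun x => f x * conjc (g x) * (weight x)%:C).

Definition normw (f : R -> R[i]) : R := Num.sqrt (complex.Re (innerw f f)).

Definition orthogonal_family (J : eqType) (D : set J) (e : J -> R -> R[i])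
    : Prop :=
  (forall i, D i -> L2w (e i) /\ ~ ae_zero (e i)) /\
  (forall i j, D i -> D j -> i != j -> innerw (e i) (e j) = 0).

(* Completeness is maximality: no non-zero vector is orthogonal to the
   whole family. *)
Definition complete_orthogonal_family (J : eqType) (D : set J)
    (e : J -> R -> R[i]) : Prop :=
  orthogonal_family D e /\
  forall f, L2w f -> (forall i, D i -> innerw f (e i) = 0) -> ae_zero f.

Definition dense_in_L2w (S : set (R -> R[i])) : Prop :=
  S `<=` L2w /\
  forall f, L2w f -> forall eps : R, 0 < eps ->
    exists2 g, S g & normw (fun x => f x - g x) < eps.

Definition polyfun (p : {poly R[i]}) (x : R) : R[i] := p.[x%:C].

(* The case 'C(n.-1, n) = 0 holds by definition of 'C. *)
Definition jacobi_m1m1 (n : nat) : {poly R[i]} :=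
  \sum_(j < n.+1)
    ('C(n.-1, j) * 'C(n.-1, n - j))%:R *:
      ((2^-1 *: ('X - 1)) ^+ j * (2^-1 *: ('X + 1)) ^+ (n - j)).

Definition Pm1 : set {poly R[i]} :=
  [set p : {poly R[i]} | [/\ (3 <= size p)%N, p.[1] = 0 & p.[-1] = 0]].

End WeightedL2.

(* Main.v *)
Require Import Defs.
From mathcomp Require Import all_boot all_order all_algebra.
From mathcomp Require Import complex.
From mathcomp Require Import all_classical all_reals all_analysis.
From mathcomp Require Import measurable_realfun ring lra zify.

(* The polynomials J_n = [jacobi_m1m1 R n] vanish at -1 and 1 and solve
   (x^2 - 1) J_n'' = n (n - 1) J_n, a self-adjoint eigenvalue problem for the weight
   1 / (1 - x^2) with distinct eigenvalues: hence they are orthogonal.  Since J_n has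
   degree n, the J_n with n >= 2 span all polynomials vanishing at -1 and 1, that is the
   (1 - x^2) q.  Such polynomials are dense: after division by 1 - x^2 this is the density
   of polynomials in L^2((1 - x^2) dx), which follows from truncation, density of
   continuous functions in L^1 and Weierstrass' theorem (by Bernstein polynomials).
   A function f orthogonal to a dense subspace is at distance at least its norm from
   every element of that subspace, so it is null. *)

Set Implicit Arguments.
Unset Strict Implicit.
Unset Printing Implicit Defensive.
Import Order.TTheory GRing.Theory Num.Theory.
Import numFieldNormedType.Exports.

Local Open Scope classical_set_scope.
Local Open Scope ring_scope.

(** * The polynomials J_n *)

Section JacobiPolynomial.
Variable F : numFieldType.
Implicit Types (n j k : nat).

(** [A] and [B] stand for (X - 1) / 2 and (X + 1) / 2, and [h] for the constant 1/2, kept opaque so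
    that [ring] can compute. The factor 4 A B compensates the two exponents lost by differentiation,
    leaving terms with both exponents kept or shifted by one in opposite directions. *)
Lemma deriv2_linear_exprM (A B h : {poly F}) j k :
  A^`() = h -> B^`() = h -> h^`() = 0 -> 4%:R * h * h = 1 ->
  4%:R * A * B * (A ^+ j * B ^+ k)^`(2) =
  (j * j.-1)%:R * (A ^+ j.-1 * B ^+ k.+1) + (2 * (j * k))%:R * (A ^+ j * B ^+ k)
  + (k * k.-1)%:R * (A ^+ j.+1 * B ^+ k.-1).
Proof.
move=> dA dB dh h4.
have dAB m p : (A ^+ m * B ^+ p)^`() =
    h * (m%:R * (A ^+ m.-1 * B ^+ p) + p%:R * (A ^+ m * B ^+ p.-1)).
  by rewrite derivM !deriv_exp dA dB; ring.
have dn (n : nat) p : (n%:R * p)^`() = n%:R * p^`() :> {poly F}.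
  by rewrite mulr_natl derivMn [RHS]mulr_natl.
rewrite -[RHS]mul1r -[X in _ = X * _]h4 derivSn derivn1 dAB derivM dh mul0r add0r.
rewrite derivD !dn !dAB.
(* Truncated predecessors: the exponents 0 and 1 are treated apart, where the offending coefficients
   vanish. *)
by case: j => [|[|j]]; case: k => [|[|k]]; rewrite /= ?natrM ?exprS ?expr0; ring.
Qed.

Local Notation a := (2^-1 *: ('X - 1) : {poly F}).
Local Notation b := (2^-1 *: ('X + 1) : {poly F}).

Definition jacobi_coef n j : nat := 'C(n.-1, j) * 'C(n.-1, n - j).

(* [jacobi_m1m1 R n] over an arbitrary field, so that its real version makes sense. *)
Definition jacobi n : {poly F} :=
  \sum_(j < n.+1) (jacobi_coef n j)%:R *: (a ^+ j * b ^+ (n - j)).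

Lemma half_linearM : 4%:R * a * b = 'X^2 - 1.
Proof.
have h4 : 4%:R * (2^-1)%:P * (2^-1)%:P = 1 :> {poly F}.
  by rewrite -[4%:R]polyC_natr -!polyCM -polyC1; congr (_%:P); field.
rewrite -!mul_polyC -[RHS]mul1r -[X in _ = X * _]h4; ring.
Qed.

Lemma deriv_half_linear (c : {poly F}) :
  c^`() = 0 -> (2^-1 *: ('X + c))^`() = (2^-1)%:P.
Proof. by move=> c0; rewrite derivZ derivD derivX c0 addr0 alg_polyC. Qed.

(** Each binomial factor contributes one instance of (k + 1) C(m, k + 1) = (m - k) C(m, k), with m =
    n - 1. The recurrence realigns the shifted sums in [jacobi_ode]. *)
Lemma jacobi_coefS n j : (j < n)%N ->
  (jacobi_coef n j.+1 * (j.+1 * j) = jacobi_coef n j * ((n - j) * (n - j).-1))%N.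
Proof.
case: n => // n; rewrite /jacobi_coef /= ltnS => ltjn.
rewrite subSS subSn//=.
have := mul_bin_left n j; have := mul_bin_left n (n - j); rewrite subKn//.
by nia.
Qed.

(** Applied to a^j b^(n - j), the operator yields the neighbours of indices j - 1 and j + 1 besides
    the term itself. Reindexing the two shifted sums by [jacobi_coefS] ([s1] and [s2]) swaps their
    factors j (j - 1) and (n - j) (n - j - 1), so every term gets the same total factor. *)
Lemma jacobi_ode n : ('X^2 - 1) * (jacobi n)^`(2) = (n * n.-1)%:R * jacobi n.
Proof.
pose M j : {poly F} := a ^+ j * b ^+ (n - j).
pose c j : {poly F} := (jacobi_coef n j)%:R.
have s1 : \sum_(j < n.+1) c j * ((j * j.-1)%:R * (a ^+ j.-1 * b ^+ (n - j).+1)) =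
          \sum_(j < n.+1) c j * (((n - j) * (n - j).-1)%:R * M j).
  rewrite big_ord_recl mul0n mul0r mulr0 add0r [RHS]big_ord_recr /= subnn mul0n mul0r mulr0 addr0.
  apply: eq_bigr => j _; rewrite /= /bump leq0n add1n /= !mulrA -!natrM jacobi_coefS//.
  by rewrite /M subnSK.
have s2 : \sum_(j < n.+1) c j * (((n - j) * (n - j).-1)%:R * (a ^+ j.+1 * b ^+ (n - j).-1)) =
          \sum_(j < n.+1) c j * ((j * j.-1)%:R * M j).
  rewrite big_ord_recr /= subnn mul0n mul0r mulr0 addr0 [RHS]big_ord_recl mul0n mul0r mulr0 add0r.
  apply: eq_bigr => j _; rewrite /= /bump leq0n add1n /= !mulrA -!natrM jacobi_coefS//.
  by rewrite /M subnS.
have -> : jacobi n = \sum_(j < n.+1) c j * M j.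
  by apply: eq_bigr => j _; rewrite scaler_nat [RHS]mulr_natl.
have -> : (\sum_(j < n.+1) c j * M j)^`(2) = \sum_(j < n.+1) c j * (M j)^`(2).
  rewrite linear_sum; apply: eq_bigr => j _.
  by rewrite -[LHS]/((c j * M j)^`(2)) /c -polyC_natr !mul_polyC derivnZ.
rewrite mulr_sumr -half_linearM.
under eq_bigr => j _.
  rewrite mulrCA (@deriv2_linear_exprM _ _ (2^-1)%:P); last first.
  - by rewrite -[4%:R]polyC_natr -!polyCM -polyC1; congr (_%:P); field.
  - by rewrite derivC.
  - by apply: deriv_half_linear; rewrite derivC.
  - by apply: deriv_half_linear; rewrite derivN derivC oppr0.
  rewrite mulrDr mulrDr; over.
rewrite !big_split/= s1 s2 -!big_split/= mulr_sumr; apply: eq_bigr => j _.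
rewrite -/(M j) -!mulrDr -!mulrDl mulrCA; congr (_ * (_ * _)).
(* With k = n - j this is k (k - 1) + 2 j k + j (j - 1) = (j + k) (j + k - 1). *)
rewrite -!natrD; congr (_%:R).
move: (nat_of_ord j) (leq_ord j) => i lein.
have [k nE] : exists k, n = (i + k)%N by exists (n - i)%N; rewrite subnKC.
rewrite nE addKn.
by case: i k {lein nE} => [|m] [|p] ; nia.
Qed.

(** The terms j = 0 and j = n carry the factor C(n - 1, n) = 0; every other term contains a b = (x^2
    - 1) / 4. *)
Lemma jacobi_root n (x : F) : (2 <= n)%N -> x ^+ 2 = 1 -> (jacobi n).[x] = 0.
Proof.
move=> n2 x1; rewrite horner_sum big1// => j _; rewrite hornerZ.
have [j0|j0] := posnP j.
  by rewrite /jacobi_coef j0 subn0 [X in (_ * X)%N]bin_small ?muln0 ?mul0r//; lia.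
have [jn|jn] := ltnP j n; last first.
  by rewrite /jacobi_coef bin_small ?mul0n ?mul0r//; lia.
have nj : (0 < n - j)%N by rewrite subn_gt0.
rewrite -(prednK nj) -[X in a ^+ X](prednK j0) !exprSr mulrACA !hornerM.
rewrite (_ : a.[x] * b.[x] = 0) ?mulr0//.
transitivity (4%:R^-1 * (x ^+ 2 - 1)); first by rewrite !hornerE /=; field.
by rewrite x1 subrr mulr0.
Qed.

(** All the products a^j b^(n - j) have leading coefficient 2^-n, so no cancellation can occur: the
    coefficients are natural numbers, and the one of index 1 is positive. *)
Lemma size_jacobi n : (2 <= n)%N -> size (jacobi n) = n.+1.
Proof.
move=> n2; pose Q j : {poly F} := ('X - 1) ^+ j * ('X + 1) ^+ (n - j).
have mXm : 'X - 1 \is @monic F by exact: monicXsubC.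
have XpE : 'X + 1 = 'X - (-1)%:P :> {poly F} by rewrite polyCN opprK.
have mXp : 'X + 1 \is @monic F by rewrite XpE monicXsubC.
have Qm j : Q j \is monic by rewrite monicMr ?monic_exp.
have sQ (j : 'I_n.+1) : size (Q j) = n.+1.
  rewrite size_monicM ?monic_exp ?monic_neq0 ?monic_exp// size_exp_XsubC.
  by rewrite XpE size_exp_XsubC /= addnS subnKC// leq_ord.
have JE : jacobi n = \sum_(j < n.+1) ((jacobi_coef n j)%:R * 2^-1 ^+ n) *: Q j.
  apply: eq_bigr => j _; rewrite !exprZn -scalerAl -scalerAr !scalerA -mulrA -exprD.
  by rewrite subnKC// leq_ord.
have Jn : (jacobi n)`_n = (\sum_(j < n.+1) jacobi_coef n j)%:R * 2^-1 ^+ n.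
  rewrite JE coef_sum natr_sum mulr_suml; apply: eq_bigr => j _.
  rewrite coefZ (_ : (Q j)`_n = 1) ?mulr1//.
  by rewrite -(eqP (Qm j)) lead_coefE sQ.
have n1 : (1 < n.+1)%N by lia.
apply/eqP; rewrite eqn_leq; apply/andP; split.
  rewrite JE (leq_trans (size_sum _ _ _))//; apply/bigmax_leqP => j _.
  by rewrite (leq_trans (size_scale_leq _ _))// sQ.
suff : (jacobi n)`_n != 0 by apply: contraR; rewrite -ltnNge ltnS => /leq_sizeP ->.
rewrite Jn mulf_neq0 ?expf_neq0 ?invr_neq0 ?pnatr_eq0//.
rewrite (bigD1 (Ordinal n1))//= addn_eq0 negb_and /jacobi_coef.
by rewrite muln_eq0 negb_or -!lt0n !bin_gt0; apply/orP; left; lia.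
Qed.

Lemma bubble_factor (r : {poly F}) : r.[1] = 0 -> r.[-1] = 0 ->
  exists q, r = (1 - 'X^2) * q.
Proof.
move=> /rootP/factor_theorem[s ->]; rewrite hornerM => /eqP; rewrite mulf_eq0.
have -> : ('X - 1%:P).[-1] == 0 :> F = false.
  by rewrite !hornerE -opprD oppr_eq0 -(natrD _ 1 1) pnatr_eq0.
rewrite orbF => /eqP/rootP/factor_theorem[t ->]; exists (- t).
by rewrite polyCN; ring.
Qed.

Lemma size_1subX2 : size (1 - 'X^2 : {poly F}) = 3%N.
Proof. by rewrite -opprB size_polyN -polyC1 size_XnsubC. Qed.

(** The factor 1 - X^2 already has degree 2. This yields the degree condition of [Pm1]. *)
Lemma size_bubble (p : {poly F}) : p != 0 -> p.[1] = 0 -> p.[-1] = 0 -> (2 < size p)%N.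
Proof.
move=> p0 p1 pm1; have [q pE] := bubble_factor p1 pm1.
have q0 : q != 0 by apply: contra_neq p0 => q0; rewrite pE q0 mulr0.
rewrite pE size_mul// -?size_poly_gt0 size_1subX2//.
by move: q0; rewrite -size_poly_gt0; case: (size q).
Qed.

(** The quotient J_n / (1 - X^2), read off the differential equation rather than obtained by
    division, so that J_n'' is a multiple of it by construction. *)
Definition jacobi_cofactor n : {poly F} := - (n * n.-1)%:R^-1 *: (jacobi n)^`(2).

Lemma jacobi_bubble n : (2 <= n)%N -> jacobi n = (1 - 'X^2) * jacobi_cofactor n.
Proof.
move=> n2; have n0 : (n * n.-1)%:R != 0 :> F by rewrite pnatr_eq0; lia.
rewrite /jacobi_cofactor scaleNr mulrN -mulNr opprB -scalerAr jacobi_ode.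
by rewrite -polyC_natr mul_polyC scalerA mulVf// scale1r.
Qed.

End JacobiPolynomial.

(** * Weierstrass approximation *)

Section Weierstrass.
Variable R : realType.
Implicit Types (f g : R -> R) (x y a b e K : R).

Definition bernstein_weight n (x : R) k : R :=
  'C(n, k)%:R * x ^+ k * (1 - x) ^+ (n - k).

Lemma bernstein_weight_ge0 n x k : 0 <= x <= 1 -> 0 <= bernstein_weight n x k.
Proof.
by case/andP=> x0 x1; rewrite !mulr_ge0// exprn_ge0// subr_ge0.
Qed.

Lemma sum_bernstein_weight n x : \sum_(k < n.+1) bernstein_weight n x k = 1.
Proof.
rewrite -[RHS](expr1n R n) -[in RHS](subrK x 1) exprDn.
by apply: eq_bigr => k _; rewrite /bernstein_weight -[RHS]mulr_natl; ring.
Qed.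

(** The identity k C(n + 1, k) = (n + 1) C(n, k - 1) trades a factor k for a smaller n. Taking [phi]
    k = 1 and [phi] k = k - 1 gives the first two factorial moments of the binomial law. *)
Lemma sum_bernstein_weight_shift n x (phi : nat -> R) :
  \sum_(k < n.+2) bernstein_weight n.+1 x k * (k%:R * phi k) =
  n.+1%:R * x * \sum_(k < n.+1) bernstein_weight n x k * phi k.+1.
Proof.
rewrite big_ord_recl mul0r mulr0 add0r mulr_sumr; apply: eq_bigr => k _.
rewrite /bernstein_weight /= /bump leq0n add1n subSS exprS.
have := mul_bin_diag n.+1 k => /(congr1 (fun m => m%:R : R)); rewrite !natrM => h.
rewrite (_ : _ * _ = (k.+1%:R * 'C(n.+1, k.+1)%:R) * x * x ^+ k * (1 - x) ^+ (n - k) * phi k.+1).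
  by rewrite -h; ring.
by ring.
Qed.

(** The variance of the binomial law: (k - n x)^2 is expanded in k (k - 1), k and 1, whose means are
    known. *)
Lemma bernstein_variance n x :
  \sum_(k < n.+1) bernstein_weight n x k * (k%:R - n%:R * x) ^+ 2 =
  n%:R * (x * (1 - x)).
Proof.
case: n => [|n].
  by rewrite big_ord_recl big_ord0 !mul0r subr0 expr0n mulr0 addr0.
have m1 m : \sum_(k < m.+2) bernstein_weight m.+1 x k * k%:R = m.+1%:R * x.
  have := sum_bernstein_weight_shift m x (fun=> 1).
  rewrite -mulr_suml sum_bernstein_weight !mulr1 => <-.
  by apply: eq_bigr => k _; rewrite mulr1.
have m2 : \sum_(k < n.+2) bernstein_weight n.+1 x k * (k%:R * (k%:R - 1)) =
    n.+1%:R * n%:R * x ^+ 2.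
  rewrite (sum_bernstein_weight_shift n x (fun k => k%:R - 1)).
  under eq_bigr do rewrite -natr1 addrK.
  case: n => [|n]; first by rewrite big_ord_recl big_ord0 mulr0 addr0 !(mulr0, mul0r).
  by rewrite m1; ring.
transitivity (\sum_(k < n.+2) (bernstein_weight n.+1 x k * (k%:R * (k%:R - 1))
   + (1 - 2 * (n.+1%:R * x)) * (bernstein_weight n.+1 x k * k%:R)
   + (n.+1%:R * x) ^+ 2 * bernstein_weight n.+1 x k)).
  by apply: eq_bigr => k _; ring.
rewrite !big_split/= -!mulr_sumr m1 m2 sum_bernstein_weight -natr1; ring.
Qed.

Definition bernstein n g : {poly R} :=
  \sum_(k < n.+1) (g (k%:R / n%:R) * 'C(n, k)%:R) *: ('X ^+ k * (1 - 'X) ^+ (n - k)).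

Lemma horner_bernstein n g x :
  (bernstein n g).[x] = \sum_(k < n.+1) bernstein_weight n x k * g (k%:R / n%:R).
Proof.
rewrite horner_sum; apply: eq_bigr => k _; rewrite /bernstein_weight.
by rewrite hornerZ hornerM !horner_exp !hornerE/=; ring.
Qed.

(* By the variance identity, B_n averages the modulus e + K |x - y|^2 to e + K x (1 - x) / n. *)
Lemma bernstein_approx g e K : 0 < e -> 0 <= K ->
  (forall x y, 0 <= x <= 1 -> 0 <= y <= 1 -> `|g x - g y| <= e + K * (x - y) ^+ 2) ->
  exists p : {poly R}, forall x, 0 <= x <= 1 -> `|g x - p.[x]| <= e *+ 2.
Proof.
move=> e0 K0 gK.
pose n := (Num.truncn (K / e)).+1.
have n0 : 0 < n%:R :> R by rewrite ltr0n.
have Kn : K / n%:R <= e.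
  by rewrite ler_pdivrMr// mulrC -ler_pdivrMr// ltW// truncnS_gt.
exists (bernstein n g) => x x01; have [x0 x1] := andP x01.
have w0 k := bernstein_weight_ge0 n k x01.
have gE : \sum_(k < n.+1) bernstein_weight n x k * g x = g x.
  by rewrite -mulr_suml sum_bernstein_weight mul1r.
rewrite horner_bernstein -{1}gE -sumrB.
apply: (le_trans (ler_norm_sum _ _ _)).
apply: (@le_trans _ _ (\sum_(k < n.+1) (e * bernstein_weight n x k +
    K / n%:R ^+ 2 * (bernstein_weight n x k * (k%:R - n%:R * x) ^+ 2)))).
  apply: ler_sum => k _; rewrite -mulrBr normrM ger0_norm//.
  have k01 : 0 <= (k%:R / n%:R : R) <= 1.
    by rewrite divr_ge0//= ler_pdivrMr// mul1r ler_nat leq_ord.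
  apply: le_trans (ler_wpM2l (w0 k) (gK _ _ x01 k01)) _.
  rewrite le_eqVlt; apply/orP; left; apply/eqP; field.
  by rewrite lt0r_neq0.
rewrite big_split/= -!mulr_sumr sum_bernstein_weight bernstein_variance mulr1 mulr2n lerD2l.
apply: le_trans Kn.
rewrite (_ : _ * _ = K / n%:R * (x * (1 - x))); last by field; rewrite lt0r_neq0.
by rewrite ler_piMr ?divr_ge0// ?mulr_ile1// ?subr_ge0// lerBlDr lerDl.
Qed.

(** Uniform continuity gives the bound [e] when |x - y| < d. Otherwise |f x - f y| is at most twice
    a bound N of |f|, hence at most 2 N (x - y)^2 / d^2. *)
Lemma continuous_quadratic_modulus f a b e : continuous f -> 0 < e ->
  exists2 K, 0 <= K & {in `[a, b] &, forall x y, `|f x - f y| <= e + K * (x - y) ^+ 2}.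
Proof.
move=> cf e0.
have [d /= d0 fd] : exists2 d, 0 < d &
    {in `[a, b], forall x y, `|x - y| < d -> `|f x - f y| < e}.
  pose P (d x : R) := forall y, `|x - y| < d -> `|f x - f y| < e.
  (* Uniform continuity by compactness: near each point, all small positive d satisfy [P], so some
     range of d works on the whole segment. *)
  have /compact_near_coveringP/(_ R 0^'+ P) := @segment_compact R a b.
  case=> [x _|d /= d0 dP].
    have /cvgrPdist_lt/(_ (e / 2)) := cf x.
    rewrite divr_gt0// => /(_ isT)/nbhs_ballP[r /= r0 xr].
    near=> x' d => y x'y.
    have xx' : `|x - x'| < r / 2.
      by near: x'; apply: nbhsx_ballx; rewrite divr_gt0.
    have dr : d < r / 2.
      by near: d; apply: nbhs_right_lt; rewrite divr_gt0.
    rewrite (le_lt_trans (ler_distD (f x) _ _))// [ltRHS](splitr e) ltrD//.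
      by rewrite distrC xr//= /ball/=; lra.
    apply: xr; rewrite /ball/= (le_lt_trans (ler_distD x' _ _))// [ltRHS](splitr r) ltrD//.
    exact: lt_trans dr.
  exists (d / 2); first by rewrite divr_gt0.
  move=> x abx y xy; apply: (dP (d / 2)) => //=.
  - by rewrite sub0r normrN gtr0_norm ?divr_gt0//; lra.
  - by rewrite divr_gt0.
have [M [_ Mf]] : bounded_set (f @` `[a, b]).
  by apply: compact_bounded; apply: continuous_compact;
     [exact: continuous_subspaceT|exact: segment_compact].
pose N := `|M| + 1.
have N0 : 0 <= N by rewrite addr_ge0.
have fN x : x \in `[a, b] -> `|f x| <= N.
  by move=> abx; apply: (Mf N); [rewrite ltr_pwDr// ler_norm|exists x].
have K0 : 0 <= 2 * N / d ^+ 2 by rewrite divr_ge0 ?sqr_ge0 ?mulr_ge0.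
exists (2 * N / d ^+ 2) => //.
move=> x y abx aby; have [xy|dxy] := ltP `|x - y| d.
  by rewrite (le_trans (ltW (fd _ abx _ xy)))// lerDl mulr_ge0 ?sqr_ge0.
rewrite (@le_trans _ _ (2 * N))//.
  by rewrite (le_trans (ler_normB _ _))// mulr2n mulrDl mul1r lerD ?fN.
have dd : 1 <= (d ^+ 2)^-1 * (x - y) ^+ 2.
  rewrite mulrC ler_pdivlMr ?exprn_gt0// mul1r -[leRHS]real_normK ?num_real//.
  by rewrite lerXn2r ?nnegrE// ltW.
apply: (@le_trans _ _ (2 * N * ((d ^+ 2)^-1 * (x - y) ^+ 2))).
  by rewrite ler_peMr// mulr_ge0.
by rewrite mulrA lerDr ltW.
Unshelve. all: by end_near. Qed.

(** An affine change of variable reduces to [0, 1] and multiplies the constant of the quadratic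
    modulus by (b - a)^2; [e / 2] absorbs the doubling in [bernstein_approx]. *)
Lemma weierstrass_approximation f a b e : continuous f -> a < b -> 0 < e ->
  exists p : {poly R}, {in `[a, b], forall x, `|f x - p.[x]| <= e}.
Proof.
move=> cf ab e0; have e20 : 0 < e / 2 by rewrite divr_gt0.
have [K K0 fK] := continuous_quadratic_modulus a b cf e20.
have ba0 : 0 < b - a by rewrite subr_gt0.
pose g t := f (a + t * (b - a)).
have [||p gp] := @bernstein_approx g (e / 2) (K * (b - a) ^+ 2) e20.
- by rewrite mulr_ge0// exprn_ge0// ltW.
- move=> x y /andP[x0 x1] /andP[y0 y1].
  apply: le_trans (fK _ _ _ _) _; rewrite ?in_itv/=; [nra|nra|].
  by rewrite le_eqVlt; apply/orP; left; apply/eqP; ring.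
exists (p \Po ((b - a)^-1 *: ('X - a%:P))) => x; rewrite in_itv/= => /andP[ax xb].
have := gp ((b - a)^-1 * (x - a)); rewrite horner_comp !hornerE/=.
rewrite /g (_ : a + _ = x); last by field; rewrite lt0r_neq0.
have -> : e / 2 *+ 2 = e by rewrite -mulr_natr mulfVK.
apply; rewrite mulr_ge0 ?invr_ge0 ?subr_ge0 ?(ltW ab)//=.
by rewrite ler_pdivrMl// mulr1 lerD2r.
Qed.

End Weierstrass.

(** * The real weighted space *)

Section RealWeightedL2.
Variable R : realType.
Local Notation mu := (@lebesgue_measure R).
Local Notation I11 := (`]-1, 1[%classic : set R).
Local Notation w := (@weight R).
Implicit Types (u v : R -> R) (p q r : {poly R}).

(** Integrability replaces the finite integral of [L2w], since it is what additivity and domination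
    of integrals take as input. *)
Definition L2r u : Prop :=
  measurable_fun I11 u /\ mu.-integrable I11 (EFin \o (fun x => u x ^+ 2 * w x)).

Definition innerr u v : R := \int[mu]_(x in I11) (u x * v x * w x).

Lemma I11_weight_gt0 x : I11 x -> 0 < w x.
Proof. by rewrite /= in_itv/= /weight invr_gt0 => /andP[x1 x2]; nra. Qed.

Lemma mulr_weight x : I11 x -> (1 - x ^+ 2) * w x = 1.
Proof.
by move=> /I11_weight_gt0; rewrite invr_gt0 => w0; rewrite mulfV// lt0r_neq0.
Qed.

Lemma measurable_weight : measurable_fun I11 w.
Proof.
apply: open_continuous_measurable_fun; first exact: interval_open.
move=> x; rewrite inE => /I11_weight_gt0; rewrite invr_gt0 => x1.
apply: cvgV; first by rewrite lt0r_neq0.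
apply: cvgB; first exact: cvg_cst.
exact: exprn_continuous.
Qed.

(* AM-GM stands in for Cauchy-Schwarz here. *)
Lemma integrable_mul_weight u v : L2r u -> L2r v ->
  mu.-integrable I11 (EFin \o (fun x => u x * v x * w x)).
Proof.
move=> [mu1 iu] [mv iv].
have iuv : mu.-integrable I11 (EFin \o (fun x => (u x ^+ 2 + v x ^+ 2) * w x)).
  by apply: eq_integrable (integrableD _ iu iv) => // x _ /=; rewrite -EFinD mulrDl.
apply: le_integrable iuv => //.
- apply/measurable_EFinP; apply: measurable_funM => //.
    exact: measurable_funM.
  exact: measurable_weight.
- move=> x Dx; have w0 := ltW (I11_weight_gt0 Dx).
  rewrite /= lee_fin normrM [leRHS]normrM ler_wpM2r// [leRHS]ger0_norm ?addr_ge0 ?sqr_ge0//.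
  by rewrite ler_norml; apply/andP; split; nra.
Qed.

Lemma L2rZ (c : R) u : L2r u -> L2r (fun x => c * u x).
Proof.
move=> [mu1 iu]; split; first exact: measurable_funM.
apply: eq_integrable (integrableZl _ (c ^+ 2) iu) => // x _ /=.
by rewrite -EFinM; congr EFin; ring.
Qed.

Lemma L2rD u v : L2r u -> L2r v -> L2r (fun x => u x + v x).
Proof.
move=> hu hv; have iuv := integrable_mul_weight hu hv.
move: hu hv => [mu1 iu] [mv iv]; split; first exact: measurable_funD.
apply: eq_integrable (integrableD _ (integrableD _ iu iv) (integrableZl _ 2 iuv)) => // x _ /=.
by rewrite -EFinM -!EFinD; congr EFin; ring.
Qed.

Lemma L2rB u v : L2r u -> L2r v -> L2r (fun x => u x - v x).
Proof.
move=> hu /(L2rZ (-1)) hv; have := L2rD hu hv.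
by under eq_fun do rewrite mulN1r.
Qed.

Lemma innerrC u v : innerr u v = innerr v u.
Proof. by apply: eq_Rintegral => x _; rewrite [u x * _]mulrC. Qed.

Lemma innerrDr u v1 v2 : L2r u -> L2r v1 -> L2r v2 ->
  innerr u (fun x => v1 x + v2 x) = innerr u v1 + innerr u v2.
Proof.
move=> hu h1 h2; rewrite /innerr -RintegralD//; [|exact: integrable_mul_weight..].
by apply: eq_Rintegral => x _; ring.
Qed.

Lemma innerrZr c u v : L2r u -> L2r v -> innerr u (fun x => c * v x) = c * innerr u v.
Proof.
move=> hu hv; rewrite /innerr -RintegralZl//; last exact: integrable_mul_weight.
by apply: eq_Rintegral => x _; ring.
Qed.

Lemma innerr_ge0 u : 0 <= innerr u u.
Proof.
apply: Rintegral_ge0 => x /I11_weight_gt0/ltW w0.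
by rewrite mulr_ge0// -expr2 sqr_ge0.
Qed.

(** A nonnegative integrand with zero integral vanishes almost everywhere, and the weight is
    positive on the interval. *)
Lemma innerr_eq0 u : L2r u -> innerr u u = 0 -> {ae mu, forall x, I11 x -> u x = 0}.
Proof.
move=> hu u0; have iu := integrable_mul_weight hu hu.
have mI : measurable I11 by [].
have /(ae_eq_integral_abs mu mI (measurable_int mu iu)) :
    (\int[mu]_(x in I11) `|(EFin \o (fun x => u x * u x * w x)%R) x| = 0)%E.
  transitivity (\int[mu]_(x in I11) (u x * u x * w x)%R%:E)%E.
    apply: eq_integral => x /[!inE] /I11_weight_gt0 /ltW w0.
    by rewrite /= ger0_norm// mulr_ge0// -expr2 sqr_ge0.
  rewrite -[LHS]fineK; last exact: integrable_fin_num.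
  by congr EFin.
apply: filterS => x ux0 Dx; have [/eqP] := ux0 Dx.
by rewrite !mulf_eq0 orbb (gt_eqF (I11_weight_gt0 Dx)) orbF => /eqP.
Qed.

Lemma innerr_subr u v : L2r u -> L2r v ->
  innerr (fun x => u x - v x) (fun x => u x - v x) =
  innerr u u - 2 * innerr u v + innerr v v.
Proof.
move=> hu hv; have huv := L2rB hu hv; have hv' := L2rZ (-1) hv.
have e x : u x - v x = u x + -1 * v x by rewrite mulN1r.
under [X in innerr _ X]eq_fun do rewrite e.
rewrite innerrDr// innerrZr// ![innerr (fun x => _ - _) _]innerrC.
under [X in innerr _ X]eq_fun do rewrite e.
under [X in _ + _ * innerr _ X]eq_fun do rewrite e.
by rewrite !innerrDr// !innerrZr// (innerrC v u); ring.
Qed.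

(** * Polynomials in the real weighted space *)

Lemma measurable_horner r (D : set R) : measurable_fun D (horner r).
Proof.
by apply: measurable_funTS; apply: continuous_measurable_fun; exact: continuous_horner.
Qed.

Lemma integrable_horner r : mu.-integrable I11 (EFin \o horner r).
Proof.
apply: (@integrableS _ _ _ mu `[-1, 1]) => //; first exact: subset_itv_oo_cc.
apply: continuous_compact_integrable; first exact: segment_compact.
by apply: continuous_subspaceT; exact: continuous_horner.
Qed.

Lemma Rintegral_deriv_poly p : \int[mu]_(x in I11) (p^`()).[x] = p.[1] - p.[-1].
Proof.
(* The fundamental theorem is applied on the closed interval; the endpoints do not change the
   integral. *)
rewrite /Rintegral -(@integral_itv_bndoo _ _ _ _ true false); last first.
  by apply/measurable_EFinP; exact: measurable_horner.
rewrite (@continuous_FTC2 _ (horner p^`()) (horner p))//=.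
- by apply: continuous_subspaceT; exact: continuous_horner.
- split; first by move=> x _; exact: derivable_horner.
  + by apply: cvg_at_right_filter; exact: continuous_horner.
  + by apply: cvg_at_left_filter; exact: continuous_horner.
- by move=> x _; rewrite derivE.
Qed.

Lemma horner_bubble_weight q x : I11 x -> (((1 - 'X^2) * q).[x]) * w x = q.[x].
Proof.
move=> Dx; rewrite hornerM mulrAC (_ : (1 - _).[x] = 1 - x ^+ 2); last by rewrite !hornerE.
by rewrite mulr_weight// mul1r.
Qed.

(** One of the two factors 1 - x^2 in the square cancels the weight, leaving a polynomial on a
    bounded interval. *)
Lemma L2r_bubble q : L2r (horner ((1 - 'X^2) * q)).
Proof.
split; first exact: measurable_horner.
apply: eq_integrable (integrable_horner ((1 - 'X^2) * q * q)) => // x /[!inE] Dx /=.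
by rewrite hornerM -{1}(horner_bubble_weight q Dx) expr2 mulrA.
Qed.

Lemma innerr_bubble q1 q2 :
  innerr (horner ((1 - 'X^2) * q1)) (horner ((1 - 'X^2) * q2)) =
  \int[mu]_(x in I11) ((1 - 'X^2) * q1 * q2).[x].
Proof.
apply: eq_Rintegral => x /[!inE] Dx.
by rewrite -mulrA horner_bubble_weight// -hornerM.
Qed.

(* With q_n = J_n / (1 - x^2), the equation reads J_n'' = - n (n - 1) q_n, so that
   (J_n' J_m - J_n J_m')' is a nonzero multiple of J_n J_m / (1 - x^2). *)
Lemma jacobi_orthogonal n m : (2 <= n)%N -> (2 <= m)%N -> n != m ->
  innerr (horner (jacobi R n)) (horner (jacobi R m)) = 0.
Proof.
move=> n2 m2 nm.
pose l k : R := (k * k.-1)%:R; pose q k := jacobi_cofactor R k.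
have l0 k : (2 <= k)%N -> l k != 0 by move=> k2; rewrite pnatr_eq0; lia.
have lnm : l m - l n != 0.
  by rewrite subr_eq0 eqr_nat; apply: contra nm => /eqP lE; apply/eqP; nia.
have J2 k : (2 <= k)%N -> (jacobi R k)^`()^`() = - l k *: q k.
  by move=> k2; rewrite /q /jacobi_cofactor scalerA mulrNN mulfV ?l0// scale1r.
pose W := (jacobi R n)^`() * jacobi R m - jacobi R n * (jacobi R m)^`().
have W' : W^`() = (l m - l n) *: ((1 - 'X^2) * q n * q m).
  rewrite derivB !derivM !J2// {3}(jacobi_bubble _ n2) {1}(jacobi_bubble _ m2).
  by rewrite -/(q n) -/(q m) -!mul_polyC polyCB !polyCN; ring.
have WE x : x ^+ 2 = 1 -> W.[x] = 0.
  by move=> x1; rewrite hornerD hornerN !hornerM !jacobi_root// mul0r mulr0 subr0.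
rewrite (jacobi_bubble _ n2) (jacobi_bubble _ m2) innerr_bubble.
apply: (mulfI lnm); rewrite mulr0 -RintegralZl//; last exact: integrable_horner.
transitivity (\int[mu]_(x in I11) (W^`()).[x]).
  by apply: eq_Rintegral => x _; rewrite W' hornerZ.
by rewrite Rintegral_deriv_poly !WE ?subr0 ?sqrrN ?expr1n.
Qed.

(** * Truncation and density of the multiples of 1 - x^2 *)

Definition clip (N x : R) : R := Num.max (- N) (Num.min N x).

Lemma clipP (N x : R) : 0 <= N ->
  [\/ N < x /\ clip N x = N, x < - N /\ clip N x = - N | - N <= x <= N /\ clip N x = x].
Proof.
move=> N0; rewrite /clip /Num.max /Num.min; case: (ltP N x) => [Nx|xN].
  apply: Or31; split=> //; case: ltP => // NN; lra.
case: (ltP (- N) x) => [Nx|]; first by apply: Or33; rewrite (ltW Nx).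
rewrite le_eqVlt => /predU1P[->|]; last by move=> ?; apply: Or32.
by apply: Or33; rewrite lexx; split => //; lra.
Qed.

Lemma normr_clip (N x : R) : 0 <= N -> `|clip N x| <= N.
Proof.
move=> N0; rewrite ler_norml.
by case: (clipP x N0) => [[h ->]|[h ->]|[/andP[h h'] ->]]; apply/andP; split; lra.
Qed.

Lemma sqr_sub_clip_le (N x : R) : 0 <= N -> (x - clip N x) ^+ 2 <= x ^+ 2.
Proof.
by move=> N0; case: (clipP x N0) => [[h ->]|[h ->]|[/andP[h h'] ->]]; nra.
Qed.

Lemma clip_lipschitz (N x y : R) : 0 <= N -> `|clip N x - clip N y| <= `|x - y|.
Proof.
move=> N0; have := ler_norm (x - y); have := ler_norm (y - x); rewrite distrC ler_norml.
case: (clipP x N0) => [[h ->]|[h ->]|[/andP[h h'] ->]];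
case: (clipP y N0) => [[k ->]|[k ->]|[/andP[k k'] ->]]; move=> ? ?; apply/andP; split; lra.
Qed.

Lemma measurable_clip N u (D : set R) : measurable_fun D u ->
  measurable_fun D (fun x => clip N (u x)).
Proof. by move=> mu1; apply: measurable_maxr => //; exact: measurable_minr. Qed.

Lemma clip_continuous N u : continuous u -> continuous (fun x => clip N (u x)).
Proof.
move=> cu x; apply: (@continuous_max R R (cst (- N)) (fun x => Num.min N (u x))).
  exact: cvg_cst.
by apply: (@continuous_min R R (cst N) u); [exact: cvg_cst|exact: cu].
Qed.

(** Dominated convergence: at each point the truncation at level n is exact once n exceeds |u x|,
    and [sqr_sub_clip_le] bounds the error by u^2 h. *)
Lemma clip_approx u (h : R -> R) (e : R) :
  measurable_fun I11 h -> (forall x, I11 x -> 0 <= h x) -> measurable_fun I11 u ->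
  mu.-integrable I11 (EFin \o (fun x => u x ^+ 2 * h x)) -> 0 < e ->
  exists2 N : R, 0 <= N &
    (\int[mu]_(x in I11) ((u x - clip N (u x)) ^+ 2 * h x)%:E < e%:E)%E.
Proof.
move=> mh h0 mu1 iu e0.
pose f_ (n : nat) x := ((u x - clip n%:R (u x)) ^+ 2 * h x)%:E.
have mclip n : measurable_fun I11 (fun x => (u x - clip n%:R (u x)) ^+ 2 * h x).
  apply: measurable_funM => //; apply: measurable_funX.
  by apply: measurable_funB => //; exact: measurable_clip.
have f_ge0 n x : I11 x -> 0 <= (u x - clip n%:R (u x)) ^+ 2 * h x.
  by move=> Dx; rewrite mulr_ge0 ?sqr_ge0 ?h0.
have mI : measurable I11 by [].
pose g0 : R -> \bar R := fun=> 0%E.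
have mg0 : measurable_fun I11 g0 by exact: measurable_cst.
have mf_ n : measurable_fun I11 (f_ n) by apply/measurable_EFinP; exact: mclip.
have [||||||_ + _] := @dominated_convergence _ _ _ mu I11 _ f_ g0
    (EFin \o (fun x => u x ^+ 2 * h x)).
- exact: mI.
- exact: mf_.
- exact: mg0.
- apply: aeW => x Dx; apply: cvg_near_cst.
  exists (Num.truncn `|u x|).+1 => // n /= un.
  have := truncnS_gt `|u x|; move: un; rewrite -(ler_nat R) /f_ => un ux.
  have [[uN _]|[uN _]|[_ ->]] := @clipP n%:R (u x) (ler0n _ _).
  - by exfalso; have := ler_norm (u x); lra.
  - by exfalso; have := ler_norm (- u x); rewrite normrN; lra.
  - by rewrite subrr expr0n mul0r.
- exact: iu.
- apply: aeW => x n Dx; rewrite /f_ /= lee_fin ger0_norm ?f_ge0//.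
  by rewrite ler_wpM2r ?h0// sqr_sub_clip_le.
(* The integrals of |f_n - 0| tend to 0, so they eventually enter the ray below [e]. *)
move=> /(_ [set y | (y < e%:E)%E]) [].
  by apply: open_nbhs_nbhs; split; [exact: open_ereal_lt_ereal|rewrite /= lte_fin].
move=> n _ /(_ n (leqnn _)) /= lte; exists n%:R => //.
apply: le_lt_trans lte; rewrite le_eqVlt; apply/orP; left; apply/eqP.
by apply: eq_integral => x /[!inE] Dx; rewrite /= subr0 ger0_norm// f_ge0.
Qed.

Lemma lebesgue_measure_I11 : mu I11 = 2%:E.
Proof.
rewrite lebesgue_measure_itv/= lte_fin ifT; last by lra.
by rewrite -EFinD opprK.
Qed.

(** For functions bounded by N, approximation in L^1 suffices, as (z - k)^2 <= 2 N |z - k|. Clipping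
    the L^1 approximant g at N makes it bounded without increasing its distance to z, since [clip]
    is 1-Lipschitz and fixes z. *)
Lemma continuous_L2_approx (z : R -> R) (N e : R) : 0 <= N -> measurable_fun I11 z ->
  (forall x, I11 x -> `|z x| <= N) -> 0 < e ->
  exists2 k : R -> R, continuous k &
    (\int[mu]_(x in I11) ((z x - k x) ^+ 2)%:E < e%:E)%E.
Proof.
move=> N0 mz zN e0.
have mI : measurable I11 by [].
have mI_fin : (mu I11 < +oo)%E by rewrite lebesgue_measure_I11 ltry.
have iz : mu.-integrable I11 (EFin \o z).
  apply: measurable_bounded_integrable => //.
  by exists N; split=> [|M NM x Dx]; [exact: num_real|exact: le_trans (zN _ Dx) (ltW NM)].
have [g [cg ig g0]] := approximation_continuous_integrable mI mI_fin iz.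
(* The added 1 keeps the denominator positive when N = 0 and makes 2 N d < e strict. *)
pose d := e / (2 * N + 1).
have d0 : 0 < d by rewrite divr_gt0//; lra.
move: g0 => /(_ [set y | (y < d%:E)%E]) [].
  by apply: open_nbhs_nbhs; split; [exact: open_ereal_lt_ereal|rewrite /= lte_fin].
move=> n _ /(_ n (leqnn _)) /= ltd.
have mg : measurable_fun I11 (g n) by have /integrableP[/measurable_EFinP] := ig n.
have mc : measurable_fun I11 (fun x => clip N (g n x)) by exact: measurable_clip.
exists (fun x => clip N (g n x)); first by apply: clip_continuous; exact: cg.
apply: (@le_lt_trans _ _ (\int[mu]_(x in I11) ((2 * N)%:E * `|(z x - g n x)%:E|))%E).
  apply: ge0_le_integral => //.
  - by move=> x Dx; rewrite lee_fin sqr_ge0.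
  - apply/measurable_EFinP; apply: measurable_funX.
    exact: measurable_funB.
  - apply: measurable_funeM; apply: measurableT_comp => //; apply/measurable_EFinP.
    exact: measurable_funB.
  - move=> x Dx; rewrite /= -EFinM lee_fin -[leLHS]real_normK ?num_real// expr2.
    have zE : clip N (z x) = z x.
      have := zN _ Dx; rewrite ler_norml => /andP[h1 h2].
      by case: (clipP (z x) N0) => [[h ->]|[h ->]|[_ ->]] //; lra.
    rewrite ler_pM//; last by rewrite -{1}zE clip_lipschitz.
    rewrite (le_trans (ler_normB _ _))// mulr2n mulrDl mul1r lerD ?zN// normr_clip//.
rewrite ge0_integralZl//; last 2 first.
- apply: measurableT_comp => //; apply/measurable_EFinP; exact: measurable_funB.
- by rewrite lee_fin mulr_ge0.
apply: (@le_lt_trans _ _ ((2 * N)%:E * d%:E)%E).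
  by rewrite lee_wpmul2l ?lee_fin ?mulr_ge0// ltW.
by rewrite -EFinM lte_fin /d mulrA ltr_pdivrMr; [nra|lra].
Qed.

(* Adding a small constant to p if necessary keeps the approximant nonzero. *)
Lemma weierstrass_approximation_neq0 (k : R -> R) (a b e : R) : continuous k -> a < b -> 0 < e ->
  exists2 p : {poly R}, p != 0 & {in `[a, b], forall x, `|k x - p.[x]| <= e}.
Proof.
move=> ck ab e0; have e20 : 0 < e / 2 by rewrite divr_gt0.
have [p kp] := weierstrass_approximation ck ab e20.
have [p0|p0] := eqVneq p 0; last first.
  by exists p => // x /kp kx; rewrite (le_trans kx)//; lra.
exists (e / 2)%:P; first by rewrite polyC_eq0 gt_eqF.
move=> x /kp; rewrite p0 !hornerE subr0 => kx.
by rewrite (le_trans (ler_normB _ _))// [leRHS](splitr e) lerD// ger0_norm// ltW.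
Qed.

(* With v = u / (1 - x^2) the squared distance is the integral of (v - q)^2 (1 - x^2):
   clip v, then approximate it by a continuous function, then by a polynomial q. *)
Lemma bubble_dense u (e : R) : L2r u -> 0 < e ->
  exists2 q, q != 0 & innerr (fun x => u x - ((1 - 'X^2) * q).[x])
                             (fun x => u x - ((1 - 'X^2) * q).[x]) < e.
Proof.
(* The truncation, continuity and Weierstrass errors contribute at most d, d and 2 d (the interval
   has length 2), all multiplied by 3 from (a + b + c)^2 <= 3 (a^2 + b^2 + c^2). The total 12 d is
   less than e = 18 d. *)
move=> [mu1 iu] e0; pose d := e / 18%:R.
have d0 : 0 < d by rewrite divr_gt0.
have mI : measurable I11 by [].
pose v x := u x * w x; pose h (x : R) := 1 - x ^+ 2.
have mv : measurable_fun I11 v by apply: measurable_funM => //; exact: measurable_weight.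
have hw x : I11 x -> h x * w x = 1 by exact: mulr_weight.
have h0 x : I11 x -> 0 <= h x by rewrite /h /= in_itv/= => /andP[x1 x2]; nra.
have h1 x : h x <= 1 by rewrite /h lerBlDr lerDl sqr_ge0.
have mh : measurable_fun I11 h by apply: measurable_funB => //; exact: measurable_funX.
have iv : mu.-integrable I11 (EFin \o (fun x => v x ^+ 2 * h x)).
  apply: eq_integrable iu => // x /[!inE] Dx /=; congr EFin.
  by rewrite /v -[in LHS](mulr1 (w x)) -(hw _ Dx); ring.
have [N N0 ltN] := clip_approx mh h0 mv iv d0.
have mc : measurable_fun I11 (fun x => clip N (v x)) by exact: measurable_clip.
have [k ck ltk] := continuous_L2_approx N0 mc (fun x _ => normr_clip (v x) N0) d0.
have mk : measurable_fun I11 k by apply: measurable_funTS; exact: continuous_measurable_fun.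
have N11 : -1 < 1 :> R by lra.
(* A uniform error c <= 1 with c <= d has its square at most d. *)
have [c [c0 c1 cd]] : exists c : R, [/\ 0 < c, c <= 1 & c <= d].
  have [d1|d1] := leP d 1; first by exists d.
  by exists 1; split => //; exact: ltW.
have [q q0 kq] := weierstrass_approximation_neq0 ck N11 c0.
have mq : measurable_fun I11 (horner q) by exact: measurable_horner.
exists q => //; have huq := L2rB (conj mu1 iu) (L2r_bubble q).
rewrite -lte_fin /innerr /Rintegral fineK; last first.
  by apply: integrable_fin_num => //; exact: integrable_mul_weight.
pose G1 x := (v x - clip N (v x)) ^+ 2 * h x; pose G2 x := (clip N (v x) - k x) ^+ 2.
have mG1 : measurable_fun I11 (EFin \o G1).
  apply/measurable_EFinP; apply: measurable_funM => //; apply: measurable_funX.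
  exact: measurable_funB.
have mG2 : measurable_fun I11 (EFin \o G2).
  by apply/measurable_EFinP; apply: measurable_funX; exact: measurable_funB.
have G10 x : I11 x -> (0 <= (G1 x)%:E)%E by move=> Dx; rewrite lee_fin mulr_ge0 ?sqr_ge0 ?h0.
have G20 x : I11 x -> (0 <= (G2 x)%:E)%E by move=> Dx; rewrite lee_fin sqr_ge0.
apply: (@le_lt_trans _ _ (\int[mu]_(x in I11) (3%:E * ((G1 x)%:E + ((G2 x)%:E + d%:E))))%E).
  apply: ge0_le_integral => //.
  - by move=> x Dx; rewrite lee_fin mulr_ge0 ?(ltW (I11_weight_gt0 Dx))// -expr2 sqr_ge0.
  - by have /integrableP[] := integrable_mul_weight huq huq.
  - by apply: measurable_funeM; apply: emeasurable_funD => //; exact: emeasurable_funD.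
  - move=> x Dx; rewrite -!EFinD -EFinM lee_fin.
    have -> : (u x - ((1 - 'X^2) * q).[x]) * (u x - ((1 - 'X^2) * q).[x]) * w x =
              h x * (v x - q.[x]) ^+ 2.
      have uE : u x = h x * v x by rewrite /v mulrCA hw// mulr1.
      have qE : ((1 - 'X^2) * q).[x] = h x * q.[x] by rewrite hornerM !hornerE.
      transitivity (h x * w x * (h x * (v x - q.[x]) ^+ 2)).
        by rewrite uE qE; ring.
      by rewrite hw// mul1r.
    have {}kq : (k x - q.[x]) ^+ 2 <= d.
      have : `|k x - q.[x]| <= c by apply: kq; apply: subset_itv_oo_cc.
      by rewrite ler_norml => /andP[? ?]; nra.
    rewrite /G1 /G2; set z := clip N (v x).
    have := h0 _ Dx; have := h1 x => hx1 hx0.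
    apply: (@le_trans _ _ (3 * (h x * ((v x - z) ^+ 2 + ((z - k x) ^+ 2 + (k x - q.[x]) ^+ 2))))).
      rewrite [leRHS]mulrCA ler_wpM2l//.
      have := sqr_ge0 ((v x - z) - (z - k x)); have := sqr_ge0 ((v x - z) - (k x - q.[x])).
      by have := sqr_ge0 ((z - k x) - (k x - q.[x])); nra.
    (* The factor h stays on the truncation error, which may be unbounded; on the other two it is
       removed by h <= 1. *)
    rewrite ler_wpM2l// mulrDr lerD//; first by rewrite mulrC.
    rewrite (le_trans (ler_piMl _ hx1))// ?addr_ge0 ?sqr_ge0// lerD2l//.
rewrite ge0_integralZl//; last 2 first.
- by apply: emeasurable_funD => //; exact: emeasurable_funD.
- by move=> x Dx; rewrite !adde_ge0 ?G10 ?G20// lee_fin ltW.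
rewrite ge0_integralD//; last 2 first.
- by move=> x Dx; rewrite !adde_ge0 ?G20// lee_fin ltW.
- exact: emeasurable_funD.
rewrite ge0_integralD//; last first.
- by move=> x Dx; rewrite lee_fin ltW.
rewrite integral_cst// [X in (_ + _ * X)%E](_ : _ = 2%:E); last exact: lebesgue_measure_I11.
apply: (@le_lt_trans _ _ (3%:E * (d%:E + (d%:E + d%:E * 2%:E)))%E).
  by rewrite lee_wpmul2l ?lee_fin// leeD ?(ltW ltN)// leeD2r// ltW.
by rewrite -[ltLHS]/((3 * (d + (d + d * 2)))%R%:E) lte_fin /d; lra.
Qed.

End RealWeightedL2.

(** * The complex weighted space *)

Local Open Scope complex_scope.

Section ComplexWeightedL2.
Variable R : realType.
Local Notation mu := (@lebesgue_measure R).
Local Notation I11 := (`]-1, 1[%classic : set R).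
Local Notation w := (@weight R).
Implicit Types (f g h : R -> R[i]) (p q : {poly R[i]}).

Local Notation re f := (fun x => complex.Re (f x)).
Local Notation im f := (fun x => complex.Im (f x)).

Lemma normc_sqr (z : R[i]) : Normc.normc z ^+ 2 = complex.Re z ^+ 2 + complex.Im z ^+ 2.
Proof. by case: z => a b /=; rewrite sqr_sqrtr// addr_ge0 ?sqr_ge0. Qed.

(** As |f|^2 = Re^2 + Im^2, each part is dominated by f, and the integrals of the two parts add up
    to that of f. The complex results are reduced to the real space through this equivalence. *)
Lemma L2wP f : L2w f <-> L2r (re f) /\ L2r (im f).
Proof.
split=> [[mr mi fin]|[[mr ir] [mi ii]]]; last first.
  split => //; apply: integrable_lty => //.
  apply: eq_integrable (integrableD _ ir ii) => // x _ /=.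
  by rewrite normc_sqr -EFinD mulrDl.
have mn : measurable_fun I11 (fun x => Normc.normc (f x) ^+ 2 * w x).
  rewrite [X in measurable_fun _ X](_ : _ =
    (fun x => (re f x ^+ 2 + im f x ^+ 2) * w x)); last first.
    by apply/funext => x; rewrite normc_sqr.
  apply: measurable_funM; last exact: measurable_weight.
  by apply: measurable_funD; exact: measurable_funX.
have i_n : mu.-integrable I11 (EFin \o (fun x => Normc.normc (f x) ^+ 2 * w x)).
  apply/integrableP; split; first exact/measurable_EFinP.
  apply: le_lt_trans fin; rewrite le_eqVlt; apply/orP; left; apply/eqP.
  apply: eq_integral => x /[!inE] Dx /=; rewrite ger0_norm//.
  by rewrite mulr_ge0 ?sqr_ge0// ltW// I11_weight_gt0.
have le_n (u : R -> R) : measurable_fun I11 u ->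
    (forall x, u x ^+ 2 <= Normc.normc (f x) ^+ 2) -> L2r u.
  move=> mu1 un; split=> //; apply: le_integrable i_n => //.
    apply/measurable_EFinP; apply: measurable_funM; first exact: measurable_funX.
    exact: measurable_weight.
  move=> x Dx /=; have w0 := ltW (I11_weight_gt0 Dx).
  by rewrite lee_fin normrM [leRHS]normrM ler_wpM2r// !ger0_norm ?sqr_ge0.
by split; apply: le_n => // x; rewrite normc_sqr ?lerDl ?lerDr sqr_ge0.
Qed.

Lemma innerwE f g : L2w f -> L2w g ->
  innerw f g = (innerr (re f) (re g) + innerr (im f) (im g)) +i*
               (innerr (im f) (re g) - innerr (re f) (im g)).
Proof.
move=> /L2wP[fr fi] /L2wP[gr gi]; rewrite /innerw /cintegral /innerr.
rewrite -RintegralD//; [|exact: integrable_mul_weight..].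
rewrite -RintegralB//; [|exact: integrable_mul_weight..].
by congr (_ +i* _); apply: eq_Rintegral => x _; case: (f x) => a b; case: (g x) => c d /=; ring.
Qed.

Lemma complex_ReD (y z : R[i]) : complex.Re (y + z) = complex.Re y + complex.Re z.
Proof. by case: y z => [a b] [c d]. Qed.

Lemma complex_ImD (y z : R[i]) : complex.Im (y + z) = complex.Im y + complex.Im z.
Proof. by case: y z => [a b] [c d]. Qed.

(** A sum with a negated coefficient, rather than a difference, fits [L2rD], [L2rZ] and
    [innerrDr]. *)
Lemma complex_ReM (y z : R[i]) : complex.Re (y * z) =
  complex.Re y * complex.Re z + - complex.Im y * complex.Im z.
Proof. by case: y z => [a b] [c d] /=; rewrite mulNr. Qed.

Lemma complex_ImM (y z : R[i]) : complex.Im (y * z) =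
  complex.Re y * complex.Im z + complex.Im y * complex.Re z.
Proof. by case: y z => [a b] [c d]. Qed.

Lemma L2wD f g : L2w f -> L2w g -> L2w (fun x => f x + g x).
Proof.
move=> /L2wP[fr fi] /L2wP[gr gi]; apply/L2wP; split.
  by under eq_fun do rewrite complex_ReD; exact: L2rD.
by under eq_fun do rewrite complex_ImD; exact: L2rD.
Qed.

Lemma L2wZ (c : R[i]) f : L2w f -> L2w (fun x => c * f x).
Proof.
move=> /L2wP[fr fi]; apply/L2wP; split.
  by under eq_fun do rewrite complex_ReM; apply: L2rD; exact: L2rZ.
by under eq_fun do rewrite complex_ImM; apply: L2rD; exact: L2rZ.
Qed.

Lemma L2wB f g : L2w f -> L2w g -> L2w (fun x => f x - g x).
Proof.
move=> hf /(L2wZ (-1)) hg; have := L2wD hf hg.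
by under eq_fun do rewrite mulN1r.
Qed.

Lemma innerwDr f g h : L2w f -> L2w g -> L2w h ->
  innerw f (fun x => g x + h x) = innerw f g + innerw f h.
Proof.
move=> hf hg hh; rewrite !innerwE//; last exact: L2wD.
move: hf hg hh => /L2wP[fr fi] /L2wP[gr gi] /L2wP[hr hi].
have -> : re (fun x => g x + h x) = (fun x => re g x + re h x).
  by apply/funext => x; rewrite complex_ReD.
have -> : im (fun x => g x + h x) = (fun x => im g x + im h x).
  by apply/funext => x; rewrite complex_ImD.
rewrite !innerrDr//; apply/eqP; rewrite eq_complex complex_ReD complex_ImD /=.
by apply/andP; split; apply/eqP; ring.
Qed.

Lemma innerwZr (c : R[i]) f g : L2w f -> L2w g ->
  innerw f (fun x => c * g x) = conjc c * innerw f g.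
Proof.
move=> hf hg; rewrite !innerwE//; last exact: L2wZ.
move: hf hg => /L2wP[fr fi] /L2wP[gr gi].
have -> : re (fun x => c * g x) =
    (fun x => complex.Re c * re g x + - complex.Im c * im g x).
  by apply/funext => x; rewrite complex_ReM.
have -> : im (fun x => c * g x) =
    (fun x => complex.Re c * im g x + complex.Im c * re g x).
  by apply/funext => x; rewrite complex_ImM.
rewrite !innerrDr//; [|exact: L2rZ..]; rewrite !innerrZr//.
case: c => a b; apply/eqP; rewrite eq_complex complex_ReM complex_ImM /=.
by apply/andP; split; apply/eqP; ring.
Qed.

(* By Pythagoras; together with density this gives completeness. *)
Lemma normw_sub_ge f g : L2w f -> L2w g -> innerw f g = 0 ->
  normw f <= normw (fun x => f x - g x).
Proof.
move=> hf hg fg0; have hB := L2wB hf hg.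
rewrite /normw ler_wsqrtr// !innerwE//=.
have : complex.Re (innerw f g) = 0 by rewrite fg0.
rewrite innerwE//=.
move: hf hg => /L2wP[fr fi] /L2wP[gr gi].
have -> : re (fun x => f x - g x) = (fun x => re f x - re g x).
  by apply/funext => x; case: (f x) => a b; case: (g x).
have -> : im (fun x => f x - g x) = (fun x => im f x - im g x).
  by apply/funext => x; case: (f x) => a b; case: (g x).
rewrite !innerr_subr//; have := innerr_ge0 (re g); have := innerr_ge0 (im g); lra.
Qed.

Lemma ae_zero_normw f : L2w f -> normw f = 0 -> ae_zero f.
Proof.
move=> hf /eqP; rewrite sqrtr_eq0 innerwE//=.
move: hf => /L2wP[fr fi] n0.
have r0 := innerr_ge0 (re f); have i0 := innerr_ge0 (im f).
(* A zero square root only says that its argument is nonpositive; as a sum of two nonnegative terms,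
   it forces both to vanish. *)
have /(innerr_eq0 fr) zr : innerr (re f) (re f) = 0 by apply/eqP; rewrite eq_le r0 andbT; lra.
have /(innerr_eq0 fi) zi : innerr (im f) (im f) = 0 by apply/eqP; rewrite eq_le i0 andbT; lra.
have ae_filter : Filter (nbhs (almost_everywhere mu)) by exact: ae_filter_ringOfSetsType.
move: zr zi; apply: filterS2 => x zr zi Dx.
by move: (zr Dx) (zi Dx); case: (f x) => a b /= -> ->.
Qed.

(** * Complex polynomials as pairs of real ones *)

Lemma polyfun_complex (r s : {poly R}) x :
  polyfun (map_poly (real_complex R) r + 'i *: map_poly (real_complex R) s) x = r.[x] +i* s.[x].
Proof.
rewrite /polyfun hornerD hornerZ !horner_map /=.
by apply/eqP; rewrite eq_complex /=; apply/andP; split; apply/eqP; ring.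
Qed.

Lemma complex_polyP p : exists r s : {poly R},
  p = map_poly (real_complex R) r + 'i *: map_poly (real_complex R) s.
Proof.
elim/poly_ind: p => [|p c [r [s pE]]].
  by exists 0, 0; rewrite !map_poly0 scaler0 addr0.
exists (r * 'X + (complex.Re c)%:P), (s * 'X + (complex.Im c)%:P).
rewrite !rmorphD !rmorphM /= !map_polyX !map_polyC /= {1}pE {1}(complexE c).
by rewrite polyCD polyCM -!mul_polyC; ring.
Qed.

Lemma polyfun_bubbleP p : p.[1] = 0 -> p.[-1] = 0 ->
  exists r s : {poly R}, forall x,
    polyfun p x = ((1 - 'X^2) * r).[x] +i* ((1 - 'X^2) * s).[x].
Proof.
have [r [s pE]] := complex_polyP p.
have pfE x : p.[x%:C] = r.[x] +i* s.[x] by rewrite -polyfun_complex -pE.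
have := pfE 1; have := pfE (-1); rewrite rmorphN rmorph1 => -> -> [r1 s1] [rN sN].
have [r' r'E] := bubble_factor r1 rN; have [s' s'E] := bubble_factor s1 sN.
by exists r', s' => x; rewrite -r'E -s'E -pfE.
Qed.

Lemma L2w_polyfun p : p.[1] = 0 -> p.[-1] = 0 -> L2w (polyfun p).
Proof.
move=> p1 pN; have [r [s pE]] := polyfun_bubbleP p1 pN; apply/L2wP.
by split; under eq_fun do rewrite pE; exact: L2r_bubble.
Qed.

Lemma poly_roots_seq (r : {poly R}) : r != 0 -> exists s : seq R, forall x, root r x -> x \in s.
Proof.
have [n] := ubnP (size r); elim: n r => // n IHn r rn r0.
have [[a ra]|nr] := pselect (exists a, root r a); last first.
  by exists [::] => x rx; exfalso; apply: nr; exists x.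
have /factor_theorem[q qE] := ra.
have q0 : q != 0 by apply: contra_neq r0 => q0; rewrite qE q0 mul0r.
have [|s sP] := IHn q _ q0.
  by move: rn; rewrite qE size_Mmonic ?monicXsubC// size_XsubC addn2 ltnS.
exists (a :: s) => x; rewrite qE rootM root_XsubC inE => /orP[/sP->|->//].
by rewrite orbT.
Qed.

(** One of the real and imaginary parts of p is a nonzero real polynomial, with finitely many roots.
    If p vanished almost everywhere, an interval of measure 2 would be covered by two null sets. *)
Lemma polyfun_not_ae_zero p : p != 0 -> ~ ae_zero (polyfun p).
Proof.
move=> p0 pz; have [r [s pE]] := complex_polyP p.
have pfE x : polyfun p x = r.[x] +i* s.[x] by rewrite -polyfun_complex -pE.
have [q q0 qP] : exists2 q : {poly R}, q != 0 & forall x, polyfun p x = 0 -> root q x.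
  have [r0|r0] := eqVneq r 0; last by exists r => // x; rewrite pfE => -[/rootP].
  exists s; last by move=> x; rewrite pfE => -[_ /rootP].
  by apply: contra_neq p0 => s0; rewrite pE r0 s0 !map_poly0 scaler0 addr0.
have [zs zsP] := poly_roots_seq q0.
have [N [mN N0 NP]] := pz.
have cz : countable [set` zs] by apply: finite_set_countable; exact: finite_seq.
have sub : I11 `<=` N `|` [set` zs].
  move=> x Dx; have [xz|xz] := pselect (polyfun p x = 0); first by right; exact/zsP/qP.
  by left; apply: NP => /= /(_ Dx).
have mz : measurable ([set` zs] : set R) by exact: countable_measurable.
have : (mu I11 <= mu (N `|` [set` zs]))%E.
  by apply: le_measure; rewrite ?inE//; exact: measurableU.
rewrite (null_set_setU mN mz N0 (countable_lebesgue_measure0 cz)) lebesgue_measure_I11.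
by rewrite lee_fin; lra.
Qed.

(** Orthogonality is proved for the real J_n and transferred by this identity; degree and roots are
    instead taken from the general lemmas at the field [R[i]]. *)
Lemma jacobi_m1m1E n : jacobi_m1m1 R n = map_poly (real_complex R) (jacobi R n).
Proof.
rewrite /jacobi rmorph_sum; apply: eq_bigr => j _ /=.
have mE (c d : {poly R[i]}) (c' d' : {poly R}) (a b : nat) :
    map_poly (real_complex R) c' = c -> map_poly (real_complex R) d' = d ->
    map_poly (real_complex R) (c' ^+ a * d' ^+ b) = c ^+ a * d ^+ b.
  by move=> <- <-; rewrite rmorphM !rmorphXn.
rewrite map_polyZ /= rmorph_nat; congr (_ *: _); apply/esym/mE.
  by rewrite map_polyZ /= fmorphV rmorph_nat rmorphB /= map_polyX rmorph1.
by rewrite map_polyZ /= fmorphV rmorph_nat rmorphD /= map_polyX rmorph1.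
Qed.

Lemma polyfun_jacobi n (c : R[i]) x :
  polyfun (c *: jacobi_m1m1 R n) x = c * ((jacobi R n).[x])%:C.
Proof. by rewrite /polyfun hornerZ jacobi_m1m1E horner_map. Qed.

Lemma innerw_jacobi n m (c1 c2 : R[i]) : (2 <= n)%N -> (2 <= m)%N -> n != m ->
  innerw (polyfun (c1 *: jacobi_m1m1 R n)) (polyfun (c2 *: jacobi_m1m1 R m)) = 0.
Proof.
have J0 k x : (2 <= k)%N -> x ^+ 2 = 1 -> (jacobi_m1m1 R k).[x] = 0 by exact: (@jacobi_root R[i]).
have hJ k (c : R[i]) : (2 <= k)%N -> L2w (polyfun (c *: jacobi_m1m1 R k)).
  by move=> k2; apply: L2w_polyfun; rewrite hornerZ J0// ?mulr0// ?sqrrN expr1n.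
have hj k : (2 <= k)%N -> L2r (horner (jacobi R k)).
  by move=> k2; rewrite jacobi_bubble//; exact: L2r_bubble.
move=> n2 m2 nm; rewrite innerwE; [|exact: hJ..].
have reE k (c : R[i]) : re (polyfun (c *: jacobi_m1m1 R k)) =
    (fun x => complex.Re c * (jacobi R k).[x]).
  by apply/funext => x; rewrite polyfun_jacobi complex_ReM /= mulr0 addr0.
have imE k (c : R[i]) : im (polyfun (c *: jacobi_m1m1 R k)) =
    (fun x => complex.Im c * (jacobi R k).[x]).
  by apply/funext => x; rewrite polyfun_jacobi complex_ImM /= mulr0 add0r.
have z (a b : R) : innerr (fun x => a * (jacobi R n).[x]) (fun x => b * (jacobi R m).[x]) = 0.
  rewrite innerrZr; [|exact/L2rZ/hj|exact: hj].
  rewrite innerrC innerrZr; [|exact: hj..].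
  by rewrite innerrC jacobi_orthogonal// !mulr0.
by rewrite !reE !imE !z subrr addr0.
Qed.

(** Induction on the degree: a nonzero p vanishing at both endpoints has degree n >= 2, and
    subtracting a multiple of [P n] cancels its leading term while keeping both roots. *)
Lemma innerw_vanishing_poly (P : nat -> {poly R[i]}) f p : L2w f ->
  (forall n, (2 <= n)%N -> [/\ size (P n) = n.+1, (P n).[1] = 0, (P n).[-1] = 0 &
     innerw f (polyfun (P n)) = 0]) ->
  p.[1] = 0 -> p.[-1] = 0 -> innerw f (polyfun p) = 0.
Proof.
move=> hf hP; have [N] := ubnP (size p); elim: N p => // N IHN p pN p1 pm1.
have hL n n2 := let: And4 _ a b _ := hP n n2 in L2w_polyfun a b.
have [p0|p0] := eqVneq p 0.
  have hp := L2w_polyfun p1 pm1.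
  have -> : polyfun p = (fun x => 0 * polyfun p x).
    by apply/funext => x; rewrite /polyfun p0 horner0 mulr0.
  by rewrite innerwZr// conjc0 mul0r.
have s3 := size_bubble p0 p1 pm1.
pose n := (size p).-1; have n2 : (2 <= n)%N by rewrite /n -ltnS prednK// (leq_trans _ s3).
have [sP P1 Pm1 fP] := hP n n2.
have Pn0 : P n != 0 by rewrite -size_poly_gt0 sP.
pose c := lead_coef p / lead_coef (P n); pose r := p - c *: P n.
have pr x : polyfun p x = c * polyfun (P n) x + polyfun r x.
  by rewrite /polyfun /r hornerD hornerN hornerZ addrC subrK.
have r1 : r.[1] = 0 by rewrite /r hornerD hornerN hornerZ p1 P1 mulr0 subr0.
have rm1 : r.[-1] = 0 by rewrite /r hornerD hornerN hornerZ pm1 Pm1 mulr0 subr0.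
have c0 : c != 0 by rewrite mulf_neq0 ?invr_neq0 ?lead_coef_eq0.
have rN : (size r < N)%N.
  have pn : size p = n.+1 by rewrite /n prednK// (leq_trans _ s3).
  apply: (@leq_ltn_trans n); last by move: pN; rewrite pn.
  apply/leq_sizeP => j; rewrite coefB coefZ leq_eqVlt => /predU1P[<-|nj].
    have -> : (P n)`_n = lead_coef (P n) by rewrite lead_coefE sP.
    by rewrite /c mulfVK ?lead_coef_eq0// lead_coefE subrr.
  by rewrite !nth_default ?mulr0 ?subr0// ?sP ?pn.
rewrite (_ : polyfun p = fun x => c * polyfun (P n) x + polyfun r x); last exact/funext.
rewrite innerwDr//; [|exact/L2wZ/hL|exact: L2w_polyfun].
by rewrite innerwZr ?fP ?mulr0 ?add0r ?IHN//; exact: hL.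
Qed.

(** The real and imaginary parts are approximated separately, each with squared error below e^2 / 2.
    Choosing the first cofactor nonzero makes p nonzero, hence of degree at least 2. *)
Lemma Pm1_dense : dense_in_L2w ((@polyfun R) @` (@Pm1 R)).
Proof.
split=> [_ [p [_ p1 pm1] <-]|f hf e e0]; first exact: L2w_polyfun.
have [fr fi] := (L2wP f).1 hf.
have d0 : 0 < e ^+ 2 / 2 by rewrite divr_gt0// exprn_gt0.
have [q1 q10 h1] := bubble_dense fr d0; have [q2 _ h2] := bubble_dense fi d0.
pose p := map_poly (real_complex R) ((1 - 'X^2) * q1) +
   'i *: map_poly (real_complex R) ((1 - 'X^2) * q2).
have pE x : polyfun p x = ((1 - 'X^2) * q1).[x] +i* ((1 - 'X^2) * q2).[x].
  exact: polyfun_complex.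
have p1 : p.[1] = 0.
  have := pE 1; rewrite /polyfun rmorph1 => ->.
  by rewrite !hornerE /= !expr1n subrr !mul0r.
have pm1 : p.[-1] = 0.
  have := pE (-1); rewrite /polyfun rmorphN rmorph1 => ->.
  by rewrite !hornerE /= !sqrrN !expr1n subrr !mul0r.
have p0 : p != 0.
  have X0 : 1 - 'X^2 != 0 :> {poly R} by rewrite -size_poly_gt0 size_1subX2.
  (* The real parts of the coefficients of p are the coefficients of (1 - X^2) q1. *)
  apply: contra_neq q10 => p0; apply: (mulfI X0); rewrite mulr0.
  apply/polyP => j; have := congr1 (fun p : {poly R[i]} => complex.Re p`_j) p0.
  by rewrite coefD coefZ !coef_map !coef0 complex_ReD complex_ReM /= mul0r mulr0 !addr0.
have hp := L2w_polyfun p1 pm1.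
exists (polyfun p).
  by exists p => //; split => //; exact: size_bubble.
have hfp := L2wB hf hp.
rewrite /normw -[e]gtr0_norm// -sqrtr_sqr ltr_sqrt ?exprn_gt0// innerwE//=.
have -> : re (fun x => f x - polyfun p x) = (fun x => re f x - ((1 - 'X^2) * q1).[x]).
  by apply/funext => x; rewrite pE; case: (f x).
have -> : im (fun x => f x - polyfun p x) = (fun x => im f x - ((1 - 'X^2) * q2).[x]).
  by apply/funext => x; rewrite pE; case: (f x).
by rewrite [ltRHS]splitr ltrD.
Qed.

End ComplexWeightedL2.

Theorem lemma2p2 (R : realType) (P : nat -> {poly R[i]})
    (hP : forall n, (2 <= n)%N ->
       exists2 c : R[i], c != 0 & P n = c *: jacobi_m1m1 R n) :
  [/\ complete_orthogonal_family [set n : nat | (2 <= n)%N]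
        (fun n => polyfun (P n)),
      dense_in_L2w ((@polyfun R) @` (@Pm1 R)) &
      forall n, (2 <= n)%N -> (P n).[1] = 0 /\ (P n).[-1] = 0].
Proof.
have PE n : (2 <= n)%N -> [/\ size (P n) = n.+1, (P n).[1] = 0 & (P n).[-1] = 0].
  move=> n2; have [c c0 ->] := hP n n2; rewrite size_scale// !hornerZ.
  have sJ : size (jacobi_m1m1 R n) = n.+1 by exact: (@size_jacobi R[i]).
  have rJ x : x ^+ 2 = 1 -> (jacobi_m1m1 R n).[x] = 0 by exact: (@jacobi_root R[i]).
  by rewrite sJ !rJ ?sqrrN ?expr1n// mulr0.
have dense := @Pm1_dense R.
split=> //; last by move=> n /PE[].
split; first split.
- move=> n /= n2; have [sP P1 Pm1] := PE n n2; split; first exact: L2w_polyfun.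
  by apply: polyfun_not_ae_zero; rewrite -size_poly_gt0 sP.
- move=> n m /= n2 m2 nm; have [c _ ->] := hP n n2; have [d _ ->] := hP m m2.
  exact: innerw_jacobi.
move=> f hf fP.
have f0 p : p.[1] = 0 -> p.[-1] = 0 -> innerw f (polyfun p) = 0.
  apply: (@innerw_vanishing_poly R P) => // n n2.
  by have [sP P1 Pm1] := PE n n2; split=> //; exact: fP.
apply: ae_zero_normw => //; apply/eqP; rewrite eq_le sqrtr_ge0 andbT leNgt.
(* Density is used with the norm of f itself as tolerance, which contradicts [normw_sub_ge]. *)
apply/negP => n0; have [_ /(_ f hf _ n0)[_ [p [_ p1 pm1] <-]]] := dense.
by rewrite ltNge normw_sub_ge ?f0//; exact: L2w_polyfun.
Qed.
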